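(* Let $L\ge 1$ and fix a neural architecture, i.e. positive integers $n_k, m_k$ ($1\le k\le L$) with $m_k=n_{k+1}$ for $1\le k\le L-1$. Let $\mathcal{N}_0=(W_0^{(k)},b_0^{(k)},t_0^{(k)})_{1\le k\le L}$ be a neural network with this architecture. Then the set $\mathcal{S}_{\mathcal{N}_0}$ of all neural networks $\mathcal{N}=(W^{(k)},b^{(k)},t^{(k)})_{1\le k\le L}$ with the same architecture that are equivalent to $\mathcal{N}_0$, regarded as a subset of $\mathbb{R}^N$ with $N=\sum_{k=1}^L m_k(n_k+2)$ by listing all entries of the $W^{(k)}$, $b^{(k)}$, $t^{(k)}$, is a semialgebraic subset of $\mathbb{R}^N$.
   Context: A neural network with architecture $(n_k,m_k)_{1\le k\le L}$ is a tuple $\mathcal{N}=(W^{(k)},b^{(k)},t^{(k)})_{1\le k\le L}$, where $W^{(k)}$ is a real $m_k\times n_k$ matrix (weights) and $b^{(k)},t^{(k)}\in\mathbb{R}^{m_k}$ (biases and thresholds), with $m_k=n_{k+1}$ for $1\le k\le L-1$. Put $\rho_k:\mathbb{R}^{n_k}\to\mathbb{R}^{m_k}$, $\rho_k(x)=W^{(k)}x+b^{(k)}$, and $\sigma_k:\mathbb{R}^{m_k}\to\mathbb{R}^{m_k}$, $\sigma_k(x)=\max\{x,t^{(k)}\}$, the maximum being taken coordinate-wise. The function associated to $\mathcal{N}$ is $\nu=\sigma_L\circ\rho_L\circ\cdots\circ\sigma_1\circ\rho_1:\mathbb{R}^{n_1}\to\mathbb{R}^{m_L}$. Two neural networks are equivalent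 if their associated functions are identically equal. A subset of $\mathbb{R}^N$ is semialgebraic if it is a finite Boolean combination (unions, intersections, complements) of sets of the form $\{P=0\}$ and $\{P>0\}$ with $P$ a real polynomial in $N$ variables. *)

(* Defs.v *)
From mathcomp Require Import all_boot all_order all_algebra.
From mathcomp Require Import boolp classical_sets reals.
From mathcomp Require Import mpoly.

Set Implicit Arguments.
Unset Strict Implicit.
Unset Printing Implicit Defensive.

Import Order.TTheory GRing.Theory Num.Theory.
Local Open Scope classical_set_scope.
Local Open Scope ring_scope.

(* Layers are numbered from 0 to L - 1, and the architecture is given by the
   widths d 0, ..., d L: layer k goes from R^(d k) to R^(d k.+1).  Thus, with
   1-based indices, n_k = d k.-1 and m_k = d k, which makes m_k = n_{k+1} hold
   by definition.  Values of d beyond L are irrelevant. *)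
Record network (R : realType) (L : nat) (d : nat -> nat) := Network {
  weight : forall k : 'I_L, 'M[R]_(d k.+1, d k);
  bias : forall k : 'I_L, 'cV[R]_(d k.+1);
  threshold : forall k : 'I_L, 'cV[R]_(d k.+1) }.

Section Network.
Variables (R : realType) (L : nat) (d : nat -> nat).
Implicit Types net : network R L d.

Definition rho net (k : 'I_L) (x : 'cV[R]_(d k)) : 'cV[R]_(d k.+1) :=
  weight net k *m x + bias net k.

Definition sigma net (k : 'I_L) (x : 'cV[R]_(d k.+1)) : 'cV[R]_(d k.+1) :=
  map2_mx Num.max x (threshold net k).

(* The composition of the first k layers. *)
Fixpoint eval_upto net (k : nat) : (k <= L)%N -> 'cV[R]_(d 0) -> 'cV[R]_(d k) :=
  match k with
  | 0 => fun _ x => x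
  | k'.+1 => fun (lt_k'L : (k' < L)%N) x =>
      @sigma net (Ordinal lt_k'L)
        (@rho net (Ordinal lt_k'L) (eval_upto net (ltnW lt_k'L) x))
  end.

Definition assoc_fun net : 'cV[R]_(d 0) -> 'cV[R]_(d L) :=
  eval_upto net (leqnn L).

Definition net_equiv (net1 net2 : network R L d) : Prop :=
  assoc_fun net1 =1 assoc_fun net2.

Definition nb_params : nat := (\sum_(k < L) d k.+1 * (d k + 2))%N.

(* The block of layer k lists, row by row, the entries of the matrix
   [W | b | t], which has d k.+1 rows and d k + 2 columns. *)
Definition params net : 'rV[R]_nb_params :=
  \mxrow_(k < L) mxvec (row_mx (weight net k)
    (row_mx (bias net k) (threshold net k)) : 'M[R]_(d k.+1, d k + 2)).

End Network.

Inductive semialgebraic (R : realType) (N : nat) : set 'rV[R]_N -> Prop :=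
| semialgebraic_eq0 (p : {mpoly R[N]}) :
    semialgebraic [set x | p.@[x 0] = 0]
| semialgebraic_gt0 (p : {mpoly R[N]}) :
    semialgebraic [set x | 0 < p.@[x 0]]
| semialgebraicU (A B : set 'rV[R]_N) :
    semialgebraic A -> semialgebraic B -> semialgebraic (A `|` B)
| semialgebraicI (A B : set 'rV[R]_N) :
    semialgebraic A -> semialgebraic B -> semialgebraic (A `&` B)
| semialgebraicC (A : set 'rV[R]_N) :
    semialgebraic A -> semialgebraic (~` A).

(* Main.v *)
(* The condition "nu_N(x) = nu_{N_0}(x) for all x" is a first-order formula over
   the real closed field R whose free variables are the parameters of N: the
   matrix of the formula is quantifier-free, since nu_N(x) is piecewise
   polynomial in (N, x) jointly.  Quantifier elimination (Tarski-Seidenberg)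
   removes the quantifier over x. *)
Require Import Defs.
From mathcomp Require Import all_boot all_order all_algebra.
From mathcomp Require Import boolp classical_sets reals.
From mathcomp Require Import mpoly.
From mathcomp Require ordered_qelim qe_rcf.
Local Open Scope classical_set_scope.

Set Implicit Arguments.
Unset Strict Implicit.
Unset Printing Implicit Defensive.

Import Order.TTheory GRing.Theory Num.Theory.
Import ordered_qelim.
Local Open Scope ring_scope.

(** * Semialgebraic sets as sets defined by first-order formulas *)

Section Semialgebraic.
Variable R : realType.

Lemma semialgebraic_setT n : semialgebraic [set: 'rV[R]_n].
Proof.
have := @semialgebraic_eq0 R n 0.
by congr semialgebraic; apply/seteqP; split=> x //= _; rewrite meval0.
Qed.

Lemma semialgebraic_set0 n : semialgebraic (@set0 'rV[R]_n).
Proof. by rewrite -setCT; apply/semialgebraicC/semialgebraic_setT. Qed.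

Lemma semialgebraic_forall n (I : finType) (A : I -> set 'rV[R]_n) :
  (forall i, semialgebraic (A i)) -> semialgebraic [set x | forall i, A i x].
Proof.
move=> sA; have sAs (s : seq I) :
    semialgebraic [set x | forall i, i \in s -> A i x].
  elim: s => [|i s IHs].
    by have := semialgebraic_setT n; congr semialgebraic; apply/seteqP; split.
  have := semialgebraicI (sA i) IHs; congr semialgebraic.
  apply/seteqP; split=> x /=.
    by move=> [Aix Asx] j; rewrite inE => /predU1P[-> //|]; apply: Asx.
  by move=> Ax; split=> [|j js]; apply: Ax; rewrite inE ?eqxx // js orbT.
by have := sAs (enum I); congr semialgebraic; apply/seteqP; split=> x /= Ax i;
  [apply: Ax; rewrite mem_enum | move=> _; apply: Ax].
Qed.

(** The environment in which formulas are evaluated at [x]: variable [i] stands for coordinate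
    [i]. *)
Definition seq_of_row n (x : 'rV[R]_n) : seq R := mktuple (x 0).

Lemma nth_seq_of_row n (x : 'rV[R]_n) (i : 'I_n) : (seq_of_row x)`_i = x 0 i.
Proof. by rewrite -tnth_nth tnth_mktuple. Qed.

Lemma size_seq_of_row n (x : 'rV[R]_n) : size (seq_of_row x) = n.
Proof. by rewrite size_tuple. Qed.

Lemma seq_of_row_mx m n (x : 'rV[R]_m) (y : 'rV[R]_n) :
  seq_of_row (row_mx x y) = seq_of_row x ++ seq_of_row y.
Proof.
apply: (@eq_from_nth _ 0) => [|i]; first by rewrite size_cat !size_tuple.
rewrite size_tuple => lt_imn; rewrite nth_cat size_tuple.
rewrite -[i]/(nat_of_ord (Ordinal lt_imn)) nth_seq_of_row.
case: (split_ordP (Ordinal lt_imn)) => j -> /=.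
  by rewrite row_mxEl nth_seq_of_row.
by rewrite row_mxEr addKn nth_seq_of_row.
Qed.

(** [GRing.rterm] excludes inverses, and the remaining term constructors are all polynomial
    operations. *)
Lemma rterm_mpoly n (t : GRing.term R) : GRing.rterm t ->
  exists p : {mpoly R[n]},
    forall x : 'rV[R]_n, GRing.eval (seq_of_row x) t = p.@[x 0].
Proof.
elim: t => //=.
- move=> i _; case: (ltnP i n) => [lt_in | le_ni].
    exists 'X_(Ordinal lt_in) => x.
    by rewrite mevalXU -nth_seq_of_row.
  (* A variable beyond the environment evaluates to the default value 0. *)
  by exists 0 => x; rewrite meval0 nth_default // size_tuple.
- by move=> c _; exists c%:MP => x; rewrite mevalC.
- by move=> k _; exists k%:R%:MP => x; rewrite mevalC.
- move=> t1 IH1 t2 IH2 /andP[/IH1[p1 p1E] /IH2[p2 p2E]].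
  by exists (p1 + p2) => x; rewrite mevalD p1E p2E.
- by move=> t IH /IH[p pE]; exists (- p) => x; rewrite mevalN pE.
- by move=> t IH k /IH[p pE]; exists (p *+ k) => x; rewrite mevalMn pE.
- move=> t1 IH1 t2 IH2 /andP[/IH1[p1 p1E] /IH2[p2 p2E]].
  by exists (p1 * p2) => x; rewrite mevalM p1E p2E.
- by move=> t IH k /IH[p pE]; exists (p ^+ k) => x; rewrite rmorphXn /= pE.
Qed.

Lemma mpoly_term n (p : {mpoly R[n]}) :
  exists t, forall x : 'rV[R]_n, GRing.eval (seq_of_row x) t = p.@[x 0].
Proof.
elim/mpolyind: p => [|c m p _ _ [t tE]].
  by exists (GRing.Const 0) => x; rewrite meval0.
pose X : GRing.term R :=
  \big[GRing.Mul/GRing.NatConst _ 1]_(i < n) GRing.Exp (GRing.Var _ i) (m i).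
exists (GRing.Add (GRing.Mul (GRing.Const c) X) t) => x /=.
rewrite mevalD mevalZ mevalX tE /X; congr (_ * _ + _).
apply: (big_rec2 (fun t y => GRing.eval (seq_of_row x) t = y)) => //= i y u _ ->.
by rewrite nth_seq_of_row.
Qed.

Lemma semialgebraic_qf n (f : ord.formula R) : ord.qf_form f -> ord.rformula f ->
  semialgebraic [set x : 'rV[R]_n | ord.holds (seq_of_row x) f].
Proof.
elim: f => //=.
- by case=> _ _;
    [have := semialgebraic_setT n | have := semialgebraic_set0 n];
    congr semialgebraic; apply/seteqP; split.
- move=> t1 t2 _ /andP[/(rterm_mpoly n)[p1 p1E] /(rterm_mpoly n)[p2 p2E]].
  have := semialgebraic_eq0 (p1 - p2); congr semialgebraic.
  by apply/seteqP; split=> x /=; rewrite mevalB -p1E -p2E;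
    [move/subr0_eq | move->; rewrite subrr].
- move=> t1 t2 _ /andP[/(rterm_mpoly n)[p1 p1E] /(rterm_mpoly n)[p2 p2E]].
  have := semialgebraic_gt0 (p2 - p1); congr semialgebraic.
  by apply/seteqP; split=> x /=; rewrite mevalB -p1E -p2E subr_gt0.
- move=> t1 t2 _ /andP[/(rterm_mpoly n)[p1 p1E] /(rterm_mpoly n)[p2 p2E]].
  have := semialgebraicC (semialgebraic_gt0 (p1 - p2)); congr semialgebraic.
  by apply/seteqP; split=> x /=;
    rewrite mevalB -p1E -p2E subr_gt0 leNgt => /negP.
- move=> f1 IH1 f2 IH2 /andP[q1 q2] /andP[r1 r2].
  exact: semialgebraicI (IH1 q1 r1) (IH2 q2 r2).
- move=> f1 IH1 f2 IH2 /andP[q1 q2] /andP[r1 r2].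
  exact: semialgebraicU (IH1 q1 r1) (IH2 q2 r2).
- move=> f1 IH1 f2 IH2 /andP[q1 q2] /andP[r1 r2].
  have := semialgebraicU (semialgebraicC (IH1 q1 r1)) (IH2 q2 r2).
  congr semialgebraic; apply/seteqP; split=> x /=; first by case.
  by move=> f12; have [/f12|] := pselect (ord.holds (seq_of_row x) f1);
    [right | left].
- by move=> f IH qf rf; apply: semialgebraicC (IH qf rf).
Qed.

(** This is where Tarski-Seidenberg enters: inverses are first removed by [to_rform], then
    quantifiers by the projection [wproj] for real closed fields. What remains is quantifier-free
    and is covered by [semialgebraic_qf]. *)
Lemma semialgebraic_holds n (f : ord.formula R) :
  semialgebraic [set x : 'rV[R]_n | ord.holds (seq_of_row x) f].
Proof.
pose rf := ord.to_rform f; have rrf : ord.rformula rf := ord.to_rform_rformula f.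
pose qf := ord.quantifier_elim
  (fun i bc => qe_rcf.qfr_to_formula (@qe_rcf.wproj R i bc)) rf.
have /andP[qqf rqf] : ord.qf_form qf && ord.rformula qf.
  exact: (ord.quantifier_elim_wf (@qe_rcf.wf_QE_wproj R)).
have := semialgebraic_qf n qqf rqf; congr semialgebraic.
have qfP e : ord.holds e f <-> ord.holds e qf.
  rewrite -ord.to_rformP.
  apply: (iff_trans (rwP (ord.quantifier_elim_rformP
    (@qe_rcf.wf_QE_wproj R) (@qe_rcf.valid_QE_wproj R) e rrf))).
  exact: iff_sym (rwP (ord.qf_evalP e qqf)).
by apply/seteqP; split=> x /= /qfP.
Qed.

Lemma semialgebraic_formula n (A : set 'rV[R]_n) : semialgebraic A ->
  exists f, forall x, ord.holds (seq_of_row x) f <-> A x.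
Proof.
elim=> [p|p|{}A B _ [f fP] _ [g gP]|{}A B _ [f fP] _ [g gP]|{}A _ [f fP]].
- have [t tE] := mpoly_term p.
  by exists (ord.Equal t (GRing.Const 0)) => x /=; rewrite tE.
- have [t tE] := mpoly_term p.
  by exists (ord.Lt (GRing.Const 0) t) => x /=; rewrite tE.
- by exists (ord.Or f g) => x /=; rewrite fP gP.
- by exists (ord.And f g) => x /=; rewrite fP gP.
- by exists (ord.Not f) => x /=; rewrite fP.
Qed.

(** The quantified variables are the [m] first indices past the end of [e], bound in increasing
    order, so each quantifier appends one value to the environment. *)
Lemma holds_foralls (e : seq R) (f : ord.formula R) m :
  ord.holds e (foldr (@ord.Forall R) f (iota (size e) m)) <->
  forall s, size s = m -> ord.holds (e ++ s) f.
Proof.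
elim: m e => [|m IHm] e /=.
  split=> [fe s /size0nil -> | /(_ [::] erefl)]; by rewrite cats0.
(* Assigning the first free index extends [e] by one entry, which keeps the induction on [m] going
   with [rcons e x] as the new environment. *)
have eE x : set_nth 0 e (size e) x = rcons e x.
  by elim: e {IHm} => //= y e ->.
split=> [fe [//|x s] [sz_s] | fe x].
  have := fe x; rewrite eE -(size_rcons e x) IHm -cat_rcons; exact.
rewrite eE -(size_rcons e x) IHm => s sz_s.
by rewrite cat_rcons; apply: fe; rewrite /= sz_s.
Qed.

(** Projection theorem in universal form: [A] is turned into a formula, its last [n] variables are
    quantified, and the result is semialgebraic by quantifier elimination. *)
Lemma semialgebraic_forall_row m n (A : set 'rV[R]_(m + n)) : semialgebraic A ->
  semialgebraic [set x : 'rV[R]_m | forall y : 'rV[R]_n, A (row_mx x y)].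
Proof.
move=> /semialgebraic_formula[f fP].
have := semialgebraic_holds m (foldr (@ord.Forall R) f (iota m n)).
congr semialgebraic; apply/seteqP; split=> x /=;
  rewrite -[X in iota X](size_seq_of_row x) holds_foralls.
  by move=> fx y; rewrite -fP seq_of_row_mx; apply: fx; rewrite size_tuple.
(* A list of length [n] is the environment of the row with the same entries. *)
move=> Ax s sz_s; have := Ax (\row_j s`_j); rewrite -fP seq_of_row_mx.
congr (ord.holds (_ ++ _) f); apply: (@eq_from_nth _ 0).
  by rewrite size_tuple.
rewrite size_tuple => i lt_in.
by rewrite -[i]/(nat_of_ord (Ordinal lt_in)) nth_seq_of_row mxE.
Qed.

End Semialgebraic.

(** * Piecewise polynomial functions *)

Section PiecewisePolynomial.
Variables (R : realType) (n : nat).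
Implicit Types (g h : 'rV[R]_n -> R) (A : set 'rV[R]_n).

(** A decision tree with semialgebraic tests at the nodes and polynomials at the leaves. With this
    encoding, closure properties follow by induction, without common refinements of partitions. *)
Inductive piecewise_poly : ('rV[R]_n -> R) -> Prop :=
| piecewise_poly_mpoly (p : {mpoly R[n]}) : piecewise_poly (fun x => p.@[x 0])
| piecewise_poly_if A g h :
    semialgebraic A -> piecewise_poly g -> piecewise_poly h ->
    piecewise_poly (fun x => if `[< A x >] then g x else h x).

(** The tree of [h] is grafted onto each leaf of the tree of [g], since [op] commutes with case
    distinctions. Only pairs of polynomial leaves remain, and there [op] may itself create a new
    test, as [Num.max] does. *)
Lemma piecewise_poly_op2 (op : R -> R -> R) :
  (forall p q : {mpoly R[n]}, piecewise_poly (fun x => op p.@[x 0] q.@[x 0])) ->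
  forall g h, piecewise_poly g -> piecewise_poly h ->
  piecewise_poly (fun x => op (g x) (h x)).
Proof.
move=> op_poly g h pg ph; elim: pg => [p|A g1 g2 sA _ IH1 _ IH2].
  elim: ph => [q|A h1 h2 sA _ IH1 _ IH2]; first exact: op_poly.
  have := piecewise_poly_if sA IH1 IH2; congr piecewise_poly.
  by apply/funext => x; case: ifP.
have := piecewise_poly_if sA IH1 IH2; congr piecewise_poly.
by apply/funext => x; case: ifP.
Qed.

Lemma piecewise_poly_cst c : piecewise_poly (fun=> c).
Proof.
have := piecewise_poly_mpoly c%:MP; congr piecewise_poly.
by apply/funext => x; rewrite mevalC.
Qed.

Lemma piecewise_poly_coord i : piecewise_poly (fun x => x 0 i).
Proof.
have := piecewise_poly_mpoly 'X_i; congr piecewise_poly.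
by apply/funext => x; rewrite mevalXU.
Qed.

Lemma piecewise_polyD g h : piecewise_poly g -> piecewise_poly h ->
  piecewise_poly (fun x => g x + h x).
Proof.
apply: piecewise_poly_op2 => p q; have := piecewise_poly_mpoly (p + q).
by congr piecewise_poly; apply/funext => x; rewrite mevalD.
Qed.

Lemma piecewise_polyB g h : piecewise_poly g -> piecewise_poly h ->
  piecewise_poly (fun x => g x - h x).
Proof.
apply: (piecewise_poly_op2 (op := fun a b => a - b)) => p q.
have := piecewise_poly_mpoly (p - q).
by congr piecewise_poly; apply/funext => x; rewrite mevalB.
Qed.

Lemma piecewise_polyM g h : piecewise_poly g -> piecewise_poly h ->
  piecewise_poly (fun x => g x * h x).
Proof.
apply: piecewise_poly_op2 => p q; have := piecewise_poly_mpoly (p * q).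
by congr piecewise_poly; apply/funext => x; rewrite mevalM.
Qed.

Lemma piecewise_poly_max g h : piecewise_poly g -> piecewise_poly h ->
  piecewise_poly (fun x => Num.max (g x) (h x)).
Proof.
apply: piecewise_poly_op2 => p q.
have := piecewise_poly_if (semialgebraic_gt0 (q - p))
  (piecewise_poly_mpoly q) (piecewise_poly_mpoly p).
congr piecewise_poly; apply/funext => x.
by rewrite /= asboolb mevalB subr_gt0.
Qed.

Lemma piecewise_poly_sum (I : finType) (g : I -> 'rV[R]_n -> R) :
  (forall i, piecewise_poly (g i)) -> piecewise_poly (fun x => \sum_i g i x).
Proof.
move=> pg; elim: (index_enum I) => [|i s IHs].
  have := piecewise_poly_cst 0; congr piecewise_poly.
  by apply/funext => x; rewrite big_nil.
have := piecewise_polyD (pg i) IHs; congr piecewise_poly.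
by apply/funext => x; rewrite big_cons.
Qed.

Lemma semialgebraic_piecewise_poly_eq0 g : piecewise_poly g ->
  semialgebraic [set x | g x = 0].
Proof.
elim=> [p|A {}g h sA _ IHg _ IHh]; first exact: semialgebraic_eq0.
have := semialgebraicU (semialgebraicI sA IHg)
  (semialgebraicI (semialgebraicC sA) IHh).
congr semialgebraic; apply/seteqP; split=> x /=.
  by case=> [] [Ax gx0]; case: asboolP.
by case: asboolP => [Ax|nAx]; [left | right].
Qed.

Lemma semialgebraic_piecewise_poly_eq g h :
  piecewise_poly g -> piecewise_poly h -> semialgebraic [set x | g x = h x].
Proof.
move=> pg ph; have := semialgebraic_piecewise_poly_eq0 (piecewise_polyB pg ph).
by congr semialgebraic; apply/seteqP; split=> x /= => [/subr0_eq|->];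
  rewrite ?subrr.
Qed.

End PiecewisePolynomial.

(** * Networks as functions of their parameters *)

Section Network.
Variables (R : realType) (L : nat) (d : nat -> nat).

(** Parameters and input both depend on a common variable [z], so that the statement covers a
    varying network as well as a fixed one. *)
Lemma piecewise_poly_eval_upto n (net : 'rV[R]_n -> network R L d)
    (x : 'rV[R]_n -> 'cV[R]_(d 0)) :
  (forall k i j, piecewise_poly (fun z => weight (net z) k i j)) ->
  (forall k i, piecewise_poly (fun z => bias (net z) k i 0)) ->
  (forall k i, piecewise_poly (fun z => threshold (net z) k i 0)) ->
  (forall i, piecewise_poly (fun z => x z i 0)) ->
  forall k (le_kL : (k <= L)%N) i,
  piecewise_poly (fun z => eval_upto (net z) le_kL (x z) i 0).
Proof.
move=> pW pb pt px; elim=> [|k IHk] le_kL i /=; first exact: px.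
set k' := Ordinal le_kL.
have := piecewise_poly_max (piecewise_polyD (piecewise_poly_sum
  (fun j => piecewise_polyM (pW k' i j) (IHk (ltnW le_kL) j))) (pb k' i)) (pt k' i).
by congr piecewise_poly; apply/funext => z; rewrite !mxE.
Qed.

(* The width is written with 1 + 1 so that lsubmx and rsubmx can separate the
   blocks of [W | b | t]. *)
Definition param_block (v : 'rV[R]_(nb_params L d)) (k : 'I_L) :
    'M[R]_(d k.+1, d k + (1 + 1)) :=
  vec_mx (submxrow v k).

Definition net_of_params (v : 'rV[R]_(nb_params L d)) : network R L d :=
  {| weight := fun k => lsubmx (param_block v k);
     bias := fun k => lsubmx (rsubmx (param_block v k));
     threshold := fun k => rsubmx (rsubmx (param_block v k)) |}.

(** Together with [paramsK], this makes [params] a bijection, so that its image of a set of networks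
    is a preimage under [net_of_params]. *)
Lemma net_of_paramsK : cancel net_of_params (@params R L d).
Proof.
move=> v; rewrite /params -[RHS]submxrowK; apply: eq_mxrow => k /=.
by rewrite !hsubmxK vec_mxK.
Qed.

Lemma paramsK : cancel (@params R L d) net_of_params.
Proof.
case=> W b t; rewrite /net_of_params.
have blockE k : param_block (params (Network W b t)) k =
    row_mx (W k) (row_mx (b k) (t k)).
  by rewrite /param_block /params mxrowK mxvecK.
by congr Network; apply: functional_extensionality_dep => k;
  rewrite blockE ?row_mxKr ?row_mxKl.
Qed.

(** The value of [l] is irrelevant: that it does not depend on [v] already makes each block entry a
    coordinate function. *)
Lemma param_block_coord k i j :
  exists l, forall v, param_block v k i j = v 0 l.
Proof. by eexists => v; rewrite !mxE. Qed.

End Network.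

Theorem theorem4p13 (R : realType) (L : nat) (d : nat -> nat)
    (L_ge1 : (1 <= L)%N) (d_gt0 : forall k, (k <= L)%N -> (0 < d k)%N)
    (net0 : network R L d) :
  @semialgebraic R (\sum_(k < L) d k.+1 * (d k + 2))%N
    [set params net | net in [set net : network R L d | net_equiv net net0]].
Proof.
pose N := nb_params L d.
(* A point [z] lists the parameters of a network followed by an input, which is transposed because
   networks act on columns. *)
pose net (z : 'rV[R]_(N + d 0)) := net_of_params (lsubmx z).
pose x (z : 'rV[R]_(N + d 0)) : 'cV[R]_(d 0) := (rsubmx z)^T.
have pblock (k : 'I_L) i j :
    piecewise_poly
      (fun z : 'rV_(N + d 0) => @param_block R L d (lsubmx z) k i j).
  have [l lE] := @param_block_coord R L d k i j.
  have := piecewise_poly_coord R (lshift (d 0) l); congr piecewise_poly.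
  by apply/funext => z; rewrite lE mxE.
have px i : piecewise_poly (fun z => x z i 0).
  have := piecewise_poly_coord R (rshift N i); congr piecewise_poly.
  by apply/funext => z; rewrite !mxE.
have pnet i : piecewise_poly (fun z => assoc_fun (net z) (x z) i 0).
  apply: piecewise_poly_eval_upto => // [k {}i j|k {}i|k {}i] /=.
  - have := pblock k i (lshift _ j); congr piecewise_poly.
    by apply/funext => z; rewrite [RHS]mxE.
  - have := pblock k i (rshift _ (lshift _ 0)); congr piecewise_poly.
    by apply/funext => z; rewrite 2![RHS]mxE.
  - have := pblock k i (rshift _ (rshift _ 0)); congr piecewise_poly.
    by apply/funext => z; rewrite 2![RHS]mxE.
(* The parameters of [net0] are constant in [z]; only the input varies. *)
have pnet0 i : piecewise_poly (fun z => assoc_fun net0 (x z) i 0).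
  by apply: piecewise_poly_eval_upto => // *; apply: piecewise_poly_cst.
(* Equality of all output coordinates is semialgebraic in [z]; quantifying over the input part
   leaves a condition on the parameters alone. *)
have := semialgebraic_forall_row (semialgebraic_forall (fun i =>
  semialgebraic_piecewise_poly_eq (pnet i) (pnet0 i))).
congr semialgebraic; apply/seteqP; split=> v /=.
  move=> eqv; exists (net_of_params v); last exact: net_of_paramsK.
  move=> y; apply/colP => i; have := eqv y^T i.
  by rewrite /net /x row_mxKl row_mxKr trmxK.
case=> net1 eq1 <- y i; rewrite /net /x row_mxKl row_mxKr paramsK.
by rewrite eq1.
Qed.
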